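(* Let $X$ be any topological space and $\mathbf M$ the ideal of meager subsets of $X$. For $a\in\wp(X)/\mathbf M$ define $\mathbf c\, a$ to be the least closed element of $\wp(X)/\mathbf M$ above $a$ (which exists). Then $(\wp(X)/\mathbf M,\mathbf c)$ is a monadic algebra.
   Context: A subset is nowhere dense if the interior of its closure is empty, and meager if it is a countable union of nowhere dense sets. In the quotient Boolean algebra $\wp(X)/\mathbf M$, $[A]$ is the class of $A$, $[A]\sqsubseteq[B]$ iff $A\setminus B$ is meager; an element is closed if it equals $[F]$ for some closed $F\subseteq X$. A closure algebra is a Boolean algebra $B$ with $\mathbf c:B\to B$ such that $a\le \mathbf c a$, $\mathbf c\mathbf c a\le \mathbf c a$, $\mathbf c(a\vee b)=\mathbf c a\vee \mathbf c b$, $\mathbf c0=0$; with $\mathbf i a:=-\mathbf c(-a)$, it is a monadic algebra if moreover $\mathbf c a=\mathbf i\mathbf c a$ for all $a$. *)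

(* Defs.v *)
From HB Require Import structures.
From mathcomp Require Import all_boot all_order generic_quotient.
From mathcomp Require Import boolp classical_sets topology.

Set Implicit Arguments.
Unset Strict Implicit.
Unset Printing Implicit Defensive.

Local Open Scope classical_set_scope.
Local Open Scope quotient_scope.

Section meager.
Context {X : topologicalType}.
Implicit Types A B C : set X.

Definition nowhere_dense A := (closure A)° = set0.

Definition meager A :=
  exists2 F : nat -> set X,
    (forall n, nowhere_dense (F n)) & A = \bigcup_n F n.

Lemma nowhere_dense0 : nowhere_dense (set0 : set X).
Proof. by rewrite /nowhere_dense closure0 interior0. Qed.

Lemma nowhere_dense_sub A B : A `<=` B -> nowhere_dense B -> nowhere_dense A.
Proof.
move=> AB B0; rewrite /nowhere_dense -subset0 -B0.
exact/interiorS/closureS.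
Qed.

Lemma meager0 : meager (set0 : set X).
Proof.
by exists (fun=> set0) => [_|]; [exact: nowhere_dense0|rewrite bigcup0].
Qed.

Lemma meager_sub A B : A `<=` B -> meager B -> meager A.
Proof.
move=> AB [F F0 BF]; exists (fun n => A `&` F n).
  by move=> n; apply: nowhere_dense_sub (F0 n) => x [].
by rewrite -setI_bigcupr -BF; apply/esym/setIidPl.
Qed.

Lemma meagerU A B : meager A -> meager B -> meager (A `|` B).
Proof.
move=> [F F0 ->] [G G0 ->].
exists (fun n => if odd n then G n./2 else F n./2).
  by move=> n; case: ifP.
apply/seteqP; split=> [x [[n _ Fx]|[n _ Gx]]|x [n _]].
- by exists n.*2 => //=; rewrite odd_double doubleK.
- by exists n.*2.+1 => //=; rewrite odd_double /= uphalf_double.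
- by case: ifP => _ Hx; [right|left]; exists n./2.
Qed.

Definition meager_eq A B : bool :=
  `[< meager ((A `\` B) `|` (B `\` A)) >].

Lemma meager_eqP A B :
  reflect (meager (A `\` B) /\ meager (B `\` A)) (meager_eq A B).
Proof.
apply: (iffP (asboolP _)) => [AB|[AB BA]]; last exact: meagerU.
by split; apply: meager_sub AB => x; [left|right].
Qed.

Lemma meager_setD_trans A B C :
  meager (A `\` B) -> meager (B `\` C) -> meager (A `\` C).
Proof.
move=> AB BC; apply: meager_sub (meagerU AB BC) => x [Ax Cx].
by have [Bx|Bx] := pselect (B x); [right|left].
Qed.

Lemma meager_setDv A : meager (A `\` A).
Proof. by rewrite setDv; exact: meager0. Qed.

Lemma meager_eq_refl : reflexive meager_eq.
Proof. by move=> A; apply/meager_eqP; split; exact: meager_setDv. Qed.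

Lemma meager_eq_sym : symmetric meager_eq.
Proof. by move=> A B; rewrite /meager_eq setUC. Qed.

Lemma meager_eq_trans : transitive meager_eq.
Proof.
move=> B A C /meager_eqP[AB BA] /meager_eqP[BC CB]; apply/meager_eqP.
by split; [exact: meager_setD_trans AB BC|exact: meager_setD_trans CB BA].
Qed.

Canonical meager_equiv :=
  EquivRel meager_eq meager_eq_refl meager_eq_sym meager_eq_trans.

End meager.

Definition pow_mod_meager (X : topologicalType) := {eq_quot @meager_equiv X}.

HB.instance Definition _ (X : topologicalType) :=
  Choice.on (pow_mod_meager X).
HB.instance Definition _ (X : topologicalType) :=
  EqQuotient.on (pow_mod_meager X).

Fact meager_display : Order.disp_t. Proof. exact: (Order.Disp tt tt). Qed.

Section boolean_algebra.
Variable X : topologicalType.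
Local Notation Q := (pow_mod_meager X).
Implicit Types (A B : set X) (a b c : Q).

Definition mclass A : Q := \pi_Q A.

Lemma class_eqP A B :
  mclass A = mclass B <-> meager (A `\` B) /\ meager (B `\` A).
Proof.
split=> [/eqP|AB]; first by rewrite eqmodE => /meager_eqP.
by apply/eqP; rewrite eqmodE; apply/meager_eqP.
Qed.

Lemma classK a : mclass (repr a) = a. Proof. exact: reprK. Qed.

Lemma class_ind (P : Q -> Prop) : (forall A, P (mclass A)) -> forall a, P a.
Proof. by move=> PA a; rewrite -(classK a). Qed.

Lemma meager_repr A :
  meager (A `\` repr (mclass A)) /\ meager (repr (mclass A) `\` A).
Proof. by apply/class_eqP; rewrite classK. Qed.

Definition qle a b : bool := `[< meager (repr a `\` repr b) >].
Definition qlt a b : bool := (b != a) && qle a b.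
Definition qmeet a b : Q := mclass (repr a `&` repr b).
Definition qjoin a b : Q := mclass (repr a `|` repr b).
Definition qcompl a : Q := mclass (~` repr a).

Lemma qle_class A B : qle (mclass A) (mclass B) <-> meager (A `\` B).
Proof.
have [A1 A2] := meager_repr A; have [B1 B2] := meager_repr B.
split=> [/asboolP|] AB.
  exact/(meager_setD_trans A1)/(meager_setD_trans AB).
by apply/asboolP/(meager_setD_trans A2)/(meager_setD_trans AB).
Qed.

Lemma qmeet_class A B : qmeet (mclass A) (mclass B) = mclass (A `&` B).
Proof.
have [A1 A2] := meager_repr A; have [B1 B2] := meager_repr B.
apply/class_eqP; split.
  apply: meager_sub (meagerU A2 B2) => x [[Ax Bx] nAB].
  by have [Ax'|] := pselect (A x); [right; split=> // Bx'; exact: nAB|left].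
apply: meager_sub (meagerU A1 B1) => x [[Ax Bx] nAB].
have [Ax'|] := pselect (repr (mclass A) x); last by left.
by right; split=> // Bx'; exact: nAB.
Qed.

Lemma qjoin_class A B : qjoin (mclass A) (mclass B) = mclass (A `|` B).
Proof.
have [A1 A2] := meager_repr A; have [B1 B2] := meager_repr B.
apply/class_eqP; split.
  by apply: meager_sub (meagerU A2 B2) => x [[Ax|Bx] nAB];
    [left|right]; split=> // H; apply: nAB; [left|right].
by apply: meager_sub (meagerU A1 B1) => x [[Ax|Bx] nAB];
  [left|right]; split=> // H; apply: nAB; [left|right].
Qed.

Lemma qcompl_class A : qcompl (mclass A) = mclass (~` A).
Proof.
have [A1 A2] := meager_repr A; apply/class_eqP; split.
  by apply: meager_sub A1 => x [nA /contrapT].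
by apply: meager_sub A2 => x [nA /contrapT].
Qed.

Fact qle_def a b : qle a b = (qmeet a b == a).
Proof.
elim/class_ind: a => A; elim/class_ind: b => B; rewrite qmeet_class.
apply/idP/eqP => [/qle_class AB|/class_eqP[_ AB]].
  apply/class_eqP; split.
    by apply: meager_sub meager0 => x [[]].
  by apply: meager_sub AB => x [Ax nAB]; split=> // Bx; exact: nAB.
by apply/qle_class; apply: meager_sub AB => x [Ax Bx]; split=> // -[].
Qed.

Fact qlt_def a b : qlt a b = (b != a) && qle a b. Proof. by []. Qed.

Fact qmeetC : commutative qmeet.
Proof.
by elim/class_ind=> A; elim/class_ind=> B; rewrite !qmeet_class setIC.
Qed.

Fact qjoinC : commutative qjoin.
Proof.
by elim/class_ind=> A; elim/class_ind=> B; rewrite !qjoin_class setUC.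
Qed.

Fact qmeetA : associative qmeet.
Proof.
elim/class_ind=> A; elim/class_ind=> B; elim/class_ind=> C.
by rewrite !qmeet_class setIA.
Qed.

Fact qjoinA : associative qjoin.
Proof.
elim/class_ind=> A; elim/class_ind=> B; elim/class_ind=> C.
by rewrite !qjoin_class setUA.
Qed.

Fact qjoinKI b a : qmeet a (qjoin a b) = a.
Proof.
elim/class_ind: a => A; elim/class_ind: b => B.
by rewrite qjoin_class qmeet_class setUC setKU.
Qed.

Fact qmeetKU b a : qjoin a (qmeet a b) = a.
Proof.
elim/class_ind: a => A; elim/class_ind: b => B.
by rewrite qmeet_class qjoin_class setIC setKI.
Qed.

Fact qmeetUl : left_distributive qmeet qjoin.
Proof.
elim/class_ind=> A; elim/class_ind=> B; elim/class_ind=> C.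
by rewrite !(qmeet_class, qjoin_class) setIUl.
Qed.

Fact qmeetxx : idempotent_op qmeet.
Proof. by elim/class_ind=> A; rewrite qmeet_class setIid. Qed.

HB.instance Definition _ :=
  Order.isMeetJoinDistrLattice.Build meager_display Q
    qle_def qlt_def qmeetC qjoinC qmeetA qjoinA qjoinKI qmeetKU qmeetUl qmeetxx.

Fact qle0x a : (mclass set0 <= a)%O.
Proof.
elim/class_ind: a => A; apply/qle_class.
by rewrite set0D; exact: meager0.
Qed.

Fact qlex1 a : (a <= mclass setT)%O.
Proof.
elim/class_ind: a => A; apply/qle_class.
by rewrite setDT; exact: meager0.
Qed.

HB.instance Definition _ := Order.hasBottom.Build meager_display Q qle0x.
HB.instance Definition _ := Order.hasTop.Build meager_display Q qlex1.

Fact qjoinxC a : (a `|` qcompl a = \top)%O.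
Proof.
by elim/class_ind: a => A; rewrite qcompl_class [LHS]qjoin_class setUv.
Qed.

Fact qmeetxC a : (a `&` qcompl a = \bot)%O.
Proof.
by elim/class_ind: a => A; rewrite qcompl_class [LHS]qmeet_class setICr.
Qed.

HB.instance Definition _ :=
  Order.TBDistrLattice_hasComplement.Build meager_display Q qjoinxC qmeetxC.

Lemma le_class A B : (mclass A <= mclass B)%O <-> meager (A `\` B).
Proof. exact: qle_class. Qed.

Lemma meet_class A B : (mclass A `&` mclass B)%O = mclass (A `&` B).
Proof. exact: qmeet_class. Qed.

Lemma join_class A B : (mclass A `|` mclass B)%O = mclass (A `|` B).
Proof. exact: qjoin_class. Qed.

Lemma compl_class A : (~` mclass A)%O = mclass (~` A).
Proof. exact: qcompl_class. Qed.

Lemma bot_class : (\bot : Q)%O = mclass set0. Proof. by []. Qed.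

Lemma top_class : (\top : Q)%O = mclass setT. Proof. by []. Qed.

End boolean_algebra.

Section closure_algebra.
Context {d : Order.disp_t} {B : ctbDistrLatticeType d}.
Variable c : B -> B.
Local Open Scope order_scope.

Record is_closure_algebra : Prop := IsClosureAlgebra {
  closure_alg_ge : forall a : B, a <= c a ;
  closure_alg_idem : forall a : B, c (c a) <= c a ;
  closure_alg_join : forall a b : B, c (a `|` b) = c a `|` c b ;
  closure_alg_bot : c \bot = \bot }.

Definition interior_op (a : B) : B := ~` c (~` a).

Definition is_monadic_algebra : Prop :=
  is_closure_algebra /\ forall a : B, c a = interior_op (c a).

End closure_algebra.

Section closure_operator.
Context {X : topologicalType}.
Implicit Types a b e : pow_mod_meager X.

Definition closed_elt b : Prop := exists2 F : set X, closed F & b = mclass F.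

Definition is_least_closed_above a b : Prop :=
  [/\ closed_elt b, (a <= b)%O &
      forall e, closed_elt e -> (a <= e)%O -> (b <= e)%O].

(* The default value of xget is irrelevant once a least closed element above
   a exists; it is then unique by antisymmetry. *)
Definition meager_closure a : pow_mod_meager X :=
  xget a [set b | is_least_closed_above a b].

End closure_operator.

(* Main.v *)
Require Import Defs.
From mathcomp Require Import all_boot all_order.
From mathcomp Require Import boolp classical_sets topology.

Set Implicit Arguments.
Unset Strict Implicit.
Unset Printing Implicit Defensive.

(** The least closed set containing [A] up to a meager set is Kuratowski's
    locus [D] of the points at which [A] is nonmeager.  That [A `\` D] is meager
    is the Banach category theorem: a maximal disjoint family of open sets in
    which [A] is meager is dense in [~` D], and disjointness glues the n-th
    nowhere dense pieces of all its members into one nowhere dense set.  Since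
    an open set differs from its closure by a nowhere dense set, the closed
    elements form a Boolean subalgebra, and mapping each element to the least
    one above it in a subalgebra is always a monadic operator. *)

Local Open Scope classical_set_scope.

Section baire_category.
Context {X : topologicalType}.
Implicit Types A B F O W : set X.

Lemma nowhere_denseP A :
  nowhere_dense A <-> forall O, open O -> O !=set0 ->
    exists V, [/\ open V, V !=set0, V `<=` O & A `&` V = set0].
Proof.
split=> [A0 O oO O0|avoidA].
  exists (O `\` closure A); split.
  - exact/openI/closed_openC/closed_closure.
  - apply/set0P/eqP; rewrite setD_eq0 open_subsetE // A0 subset0.
    exact/eqP/set0P.
  - exact: subDsetl.
  - by apply/disjoints_subset => x Ax [_]; apply; exact: subset_closure.
apply: contrapT => /eqP/set0P int0.
have [V [oV [x Vx] VA AV0]] := avoidA _ (open_interior _) int0.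
have clAx : closure A x := interior_subset (VA x Vx).
have [y] := clAx V (open_nbhs_nbhs (conj oV Vx)).
by rewrite AV0.
Qed.

Lemma nowhere_dense_closureD W : open W -> nowhere_dense (closure W `\` W).
Proof.
move=> oW; rewrite /nowhere_dense setDE -(closure_id _).1.
  by rewrite interiorI interiorC -subset0 => x [/interior_subset].
by apply: closedI; [exact: closed_closure|exact: open_closedC].
Qed.

Lemma nowhere_dense_meager A : nowhere_dense A -> meager A.
Proof.
by move=> A0; exists (fun=> A); rewrite ?bigcup_const //; exists 0%N.
Qed.

Lemma subset_meager_setD A B : A `<=` B -> meager (A `\` B).
Proof. by rewrite -setD_eq0 => ->; exact: meager0. Qed.

Lemma nowhere_dense_bigcup_disjoint I (D : set I) (U N : I -> set X) :
    (forall i, D i -> open (U i)) -> trivIset D U ->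
    (forall i, D i -> N i `<=` U i) ->
    (forall i, D i -> nowhere_dense (N i)) ->
  nowhere_dense (\bigcup_(i in D) N i).
Proof.
move=> oU tU NU N0; apply/nowhere_denseP => O oO O0.
have [[i [Di OUi]]|OU0] := pselect (exists i, D i /\ O `&` U i !=set0).
  have oOUi : open (O `&` U i) := openI oO (oU i Di).
  have [V [oV V0 VOU NV0]] := (nowhere_denseP (N i)).1 (N0 i Di) _ oOUi OUi.
  exists V; split=> // [x /VOU[]//|].
  rewrite -subset0 => x [[j Dj Njx] Vx]; rewrite -NV0; split=> //.
  suff <- : j = i by [].
  by apply: tU => //; exists x; split; [exact: NU|have [] := VOU x Vx].
exists O; split=> //; rewrite -subset0 => x [[i Di Nix] Ox].
by apply: OU0; exists i; split=> //; exists x; split=> //; exact: NU Nix.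
Qed.

Lemma meager_bigcup_disjoint I (D : set I) (U M : I -> set X) :
    (forall i, D i -> open (U i)) -> trivIset D U ->
    (forall i, D i -> M i `<=` U i) ->
    (forall i, D i -> meager (M i)) ->
  meager (\bigcup_(i in D) M i).
Proof.
move=> oU tU MU mM.
have /choice[N NE] i : exists N : nat -> set X, D i ->
    (forall n, nowhere_dense (N n)) /\ M i = \bigcup_n N n.
  have [/mM[N N0 MN]|nDi] := pselect (D i); first by exists N.
  by exists (fun=> set0).
exists (fun n => \bigcup_(i in D) N i n) => [n|].
  apply: (nowhere_dense_bigcup_disjoint (U := U)) => // i Di.
    by apply: subset_trans (MU i Di); rewrite (NE i Di).2; exact: bigcup_sup.
  exact: (NE i Di).1.
apply/seteqP; split=> [x [i Di]|x [n _ [i Di Nx]]].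
  by rewrite (NE i Di).2 => -[n _ Nx]; exists n => //; exists i.
by exists i; rewrite // (NE i Di).2; exists n.
Qed.

Lemma maximal_disjoint_open_dense (P E : set (set X)) :
    (forall O, P O -> open O) ->
    (forall O V, P O -> open V -> V `<=` O -> P V) ->
    maximal_disjoint_subcollection id E P ->
  \bigcup_(O in P) O `<=` closure (\bigcup_(O in E) O).
Proof.
set W := \bigcup_(O in E) O => oP downP [EP tE maxE] x [O PO Ox].
apply: contrapT => nWx; pose V := O `\` closure W.
have UV0 U : E U -> U `&` V = set0.
  move=> EU; apply/disjoints_subset => y Uy [_]; apply.
  by apply: subset_closure; exists U.
have Vx : V x by [].
have nEV : ~ E V by move=> /UV0; rewrite setIid => V0; rewrite V0 in Vx.
apply: (maxE (E `|` [set V])).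
- by split=> [|EVE]; [exact: subsetUl|apply/nEV/EVE; right].
- move=> U [/EP//|->]; apply: (downP O) => //; last exact: subDsetl.
  by apply: openI; [exact: oP|exact/closed_openC/closed_closure].
- move=> U U' [EU|->] [EU'|->] //.
  + exact: tE.
  + by rewrite UV0 // => -[].
  + by rewrite setIC UV0 // => -[].
Qed.

Theorem banach_category I (D : set I) (U : I -> set X) A :
    (forall i, D i -> open (U i)) ->
    (forall i, D i -> meager (A `&` U i)) ->
  meager (A `&` \bigcup_(i in D) U i).
Proof.
move=> oU mAU; pose P := [set O | open O /\ meager (A `&` O)].
have oP O : P O -> open O by case.
have downP O V : P O -> open V -> V `<=` O -> P V.
  by move=> [_ mAO] oV VO; split=> //; apply: meager_sub mAO; exact: setIS.
have [E maxE] := ex_maximal_disjoint_subcollection id P.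
have [EP tE _] := maxE; pose W := \bigcup_(V in E) V.
have mAW : meager (A `&` W).
  rewrite setI_bigcupr.
  by apply: (meager_bigcup_disjoint (U := id)) => // V /EP[].
have oW : open W by apply: bigcup_open => V /EP[].
have mbW := nowhere_dense_meager (nowhere_dense_closureD oW).
apply: meager_sub (meagerU mAW mbW) => x [Ax [i Di Uix]].
have [Wx|nWx] := pselect (W x); [by left|right; split=> //].
apply: (maximal_disjoint_open_dense oP downP maxE).
by exists (U i) => //; split; [exact: oU|exact: mAU].
Qed.

Definition nonmeager_locus A :=
  [set x | forall O, open_nbhs x O -> ~ meager (A `&` O)].

Lemma nonmeager_locusC A :
  ~` nonmeager_locus A = \bigcup_(O in [set O | open O /\ meager (A `&` O)]) O.
Proof.
apply/seteqP; split=> [x|x [O [oO mAO] Ox]]; last by move=> /(_ O); apply.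
by move=> /existsNP[O /not_implyP[[oO Ox] /contrapT mAO]]; exists O.
Qed.

Lemma closed_nonmeager_locus A : closed (nonmeager_locus A).
Proof. by rewrite -openC nonmeager_locusC; apply: bigcup_open => O []. Qed.

Lemma meager_setD_nonmeager_locus A : meager (A `\` nonmeager_locus A).
Proof.
by rewrite setDE nonmeager_locusC; apply: banach_category => O [].
Qed.

Lemma nonmeager_locus_subset A F :
  closed F -> meager (A `\` F) -> nonmeager_locus A `<=` F.
Proof.
move=> cF mAF x Ax; apply: contrapT => nFx.
by apply: (Ax (~` F)) => //; split=> //; exact: closed_openC.
Qed.

End baire_category.

Section least_above.
Context {d : Order.disp_t} {B : ctbDistrLatticeType d}.
Import Order.LTheory Order.CTheory.
Local Open Scope order_scope.
Variables (S : set B) (c : B -> B).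
Hypothesis c_least_above : forall a,
  [/\ S (c a), a <= c a & forall e, S e -> a <= e -> c a <= e].

Lemma least_above_id a : S a -> c a = a.
Proof.
move=> Sa; have [_ a_le ca_le] := c_least_above a.
by apply/le_anti; rewrite a_le ca_le.
Qed.

Lemma le_least_above a b : a <= b -> c a <= c b.
Proof.
move=> ab; have [_ _ ca_le] := c_least_above a.
have [Scb b_le _] := c_least_above b.
by apply: ca_le => //; exact: le_trans b_le.
Qed.

Lemma least_above_closure_algebra :
    S \bot -> (forall a b, S a -> S b -> S (a `|` b)) ->
  is_closure_algebra c.
Proof.
move=> S0 SU; split=> [a|a|a b|]; last exact: least_above_id.
- by have [] := c_least_above a.
- by rewrite least_above_id //; have [] := c_least_above a.
have [Sca a_le _] := c_least_above a; have [Scb b_le _] := c_least_above b.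
have [_ _ cab_le] := c_least_above (a `|` b).
apply/le_anti/andP; split; first by apply: cab_le; [exact: SU|exact: leU2].
by rewrite leUx !le_least_above ?leUl ?leUr.
Qed.

Lemma least_above_monadic_algebra :
    S \bot -> (forall a b, S a -> S b -> S (a `|` b)) ->
    (forall a, S a -> S (~` a)) ->
  is_monadic_algebra c.
Proof.
move=> S0 SU SC; split=> [|a]; first exact: least_above_closure_algebra.
have [Sca _ _] := c_least_above a.
by rewrite /interior_op (least_above_id (SC _ Sca)) complK.
Qed.

End least_above.

Section closed_elements.
Context {X : topologicalType}.
Implicit Types a b : pow_mod_meager X.
Local Open Scope order_scope.

Lemma closed_elt0 : closed_elt (\bot : pow_mod_meager X).
Proof. by exists set0; [exact: closed0|exact: bot_class]. Qed.

Lemma closed_eltU a b : closed_elt a -> closed_elt b -> closed_elt (a `|` b).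
Proof.
move=> [F cF ->] [G cG ->]; exists (F `|` G)%classic; first exact: closedU.
exact: join_class.
Qed.

Lemma closed_eltC a : closed_elt a -> closed_elt (~` a).
Proof.
move=> [F cF ->]; exists (closure (~` F)); first exact: closed_closure.
rewrite compl_class; apply/class_eqP; split.
  exact/subset_meager_setD/subset_closure.
exact/nowhere_dense_meager/nowhere_dense_closureD/closed_openC.
Qed.

Lemma least_closed_above_class (A : set X) :
  is_least_closed_above (mclass A) (mclass (nonmeager_locus A)).
Proof.
split.
- by exists (nonmeager_locus A) => //; exact: closed_nonmeager_locus.
- exact/le_class/meager_setD_nonmeager_locus.
- move=> _ [F cF ->] /le_class mAF; apply/le_class.
  by apply: subset_meager_setD; exact: nonmeager_locus_subset.
Qed.

Lemma ex_least_closed_above a : exists b, is_least_closed_above a b.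
Proof.
elim/class_ind: a => A.
by exists (mclass (nonmeager_locus A)); exact: least_closed_above_class.
Qed.

Lemma meager_closureP a : is_least_closed_above a (meager_closure a).
Proof. exact: (xgetPex a (ex_least_closed_above a)). Qed.

End closed_elements.

Theorem theorem3p9 (X : topologicalType) :
  (forall a : pow_mod_meager X,
     exists b : pow_mod_meager X, is_least_closed_above a b) /\
  is_monadic_algebra (@meager_closure X).
Proof.
split; first exact: ex_least_closed_above.
apply: (@least_above_monadic_algebra _ _ closed_elt).
- exact: meager_closureP.
- exact: closed_elt0.
- exact: closed_eltU.
- exact: closed_eltC.
Qed.
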